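(* Let $d\ge 2$ and let $Z\subset\mathbb{R}^d$ be a full-dimensional zonotope with $Z=-Z$. If $Z$ is homogeneous, i.e. all vertices of $Z$ lie on a common sphere and all edges of $Z$ have the same length, then $Z$ is a $\Gamma$-permutahedron for some finite reflection group $\Gamma\subset\mathrm{O}(\mathbb{R}^d)$.
   Context: A zonotope is a polytope that is a Minkowski sum of finitely many line segments. A finite reflection group $\Gamma\subset\mathrm{O}(\mathbb{R}^d)$ is a finite group generated by reflections $T_r=\mathrm{Id}-2rr^{\top}/\|r\|^2$, $r\in R$, for some finite set $R\subset\mathbb{R}^d\setminus\{0\}$. A $\Gamma$-permutahedron is a polytope $P\subset\mathbb{R}^d$ such that $\Gamma$ acts regularly (that is, transitively and freely) on the vertices of $P$. Equivalently, $P=\mathrm{conv}(\Gamma v)$ for a point $v$ not lying on any reflection hyperplane of $\Gamma$. *)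

(* Defs.v *)
From HB Require Import structures.
From mathcomp Require Import all_boot all_order all_algebra.
From mathcomp Require Import boolp classical_sets functions cardinality.
From mathcomp Require Import set_interval reals convex.

Set Implicit Arguments.
Unset Strict Implicit.
Unset Printing Implicit Defensive.

Import Order.TTheory GRing.Theory Num.Theory.

Local Open Scope classical_set_scope.
Local Open Scope ring_scope.

Section Euclidean.
Context {R : realType} {d : nat}.
Implicit Types (u v x y c : 'cV[R]_d) (A P F : set 'cV[R]_d).

(* The library norm on matrices is the sup norm, hence these two. *)
Definition dot u v : R := (u^T *m v) 0 0.
Definition enorm u : R := Num.sqrt (dot u u).

Definition segment u v : set 'cV[R]_d :=
  [set (1 - t) *: u + t *: v | t in `[0, 1]].

Definition conv_hull A : set 'cV[R]_d := smallest (@convex_set R 'cV[R]_d) A.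

Definition aff_hull A : set 'cV[R]_d :=
  [set x | exists (n : nat) (p : 'I_n -> 'cV[R]_d) (w : 'I_n -> R),
     [/\ forall i, A (p i), \sum_i w i = 1 & x = \sum_i w i *: p i]].

(* The dimension of a set is that of the direction space of its affine hull. *)
Definition has_dim A (k : nat) : Prop :=
  exists (x : 'cV[R]_d) (U : {vspace 'cV[R]_d}),
    aff_hull A = [set x + u | u in [set` U]] /\ (\dim U)%VS = k.

Definition full_dimensional A : Prop := has_dim A d.

Definition polytope P : Prop :=
  exists S : set 'cV[R]_d, finite_set S /\ P = conv_hull S.

Definition minkowski_sum (n : nat) (S : 'I_n -> set 'cV[R]_d) : set 'cV[R]_d :=
  [set x | exists s : 'I_n -> 'cV[R]_d,
     (forall i, S i (s i)) /\ x = \sum_i s i].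

Definition zonotope P : Prop :=
  polytope P /\
  exists (n : nat) (a b : 'I_n -> 'cV[R]_d),
    P = minkowski_sum (fun i => segment (a i) (b i)).

(* Faces are the nonempty sets of maximizers of linear functionals over a
   polytope; c = 0 gives P itself. *)
Definition face P F : Prop :=
  exists c, F = [set x | P x /\ forall y, P y -> dot c y <= dot c x].

Definition vertices P : set 'cV[R]_d := [set v | face P [set v]].

Definition edge P F : Prop := face P F /\ has_dim F 1.

(* An edge of a polytope is the segment between its two endpoints, and its
   length is the distance between them. The sphere has an arbitrary centre. *)
Definition homogeneous P : Prop :=
  (exists (c : 'cV[R]_d) (rho : R), forall v, vertices P v -> enorm (v - c) = rho)
  /\ (exists l : R, forall u v, edge P (segment u v) -> enorm (u - v) = l).

Definition orthogonal_group : set 'M[R]_d := [set g : 'M[R]_d | g^T *m g = 1%:M].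

Definition orthogonal_subgroup (G : set 'M[R]_d) : Prop :=
  [/\ G `<=` orthogonal_group,
      G 1%:M,
      (forall g h : 'M[R]_d, G g -> G h -> G (g *m h))
    & (forall g : 'M[R]_d, G g -> G (invmx g))].

Definition reflection (r : 'cV[R]_d) : 'M[R]_d :=
  1%:M - (2 / enorm r ^+ 2) *: (r *m r^T).

Definition finite_reflection_group (G : set 'M[R]_d) : Prop :=
  finite_set G /\
  exists S : set 'cV[R]_d,
    [/\ finite_set S, ~ S 0
      & G = smallest orthogonal_subgroup [set reflection r | r in S]].

Definition acts_regularly (G : set 'M[R]_d) (V : set 'cV[R]_d) : Prop :=
  [/\ (forall (g : 'M[R]_d) v, G g -> V v -> V (g *m v)),
      V !=set0,
      (forall u v, V u -> V v -> exists2 g, G g & g *m u = v)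
    & (forall (g : 'M[R]_d) v, G g -> V v -> g *m v = v -> g = 1%:M)].

Definition permutahedron (G : set 'M[R]_d) P : Prop :=
  polytope P /\ acts_regularly G (vertices P).

End Euclidean.

(* Main.v *)
Require Import Defs.
From mathcomp Require Import all_boot all_order all_algebra.
From mathcomp Require Import boolp classical_sets functions cardinality reals.
From mathcomp Require Import ring lra.

Import Order.TTheory GRing.Theory Num.Theory.

Local Open Scope classical_set_scope.
Local Open Scope ring_scope.

(** Up to translation [Z] is the sum of the segments [[-z, z]] over a list [s]
    of nonzero, pairwise non-parallel generators, and [Z = -Z] makes the
    translation trivial. Put [F = s ++ -s]. A direction [c] orthogonal to no
    element of [F] exposes the vertex [T c], the sum of the [y] in [F] with
    [<c, y> > 0], and all vertices arise in this way; a direction orthogonal to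
    a single generator [z] exposes an edge parallel to [z] of length [2 |z|].

    Homogeneity turns [F] into a root system. Equal edge lengths say that all
    of [F] has the same norm. A common sphere, necessarily centred at the
    origin, says that the two endpoints [T c + z] and [T c - z] of each edge
    are equally long, so [T c] is orthogonal to [z] ([roots_balanced]).
    Comparing the two sides of a plane [L] spanned by elements of [F], this
    condition descends to [F] intersected with [L]: for every [x] there, the
    sum of the elements on one side of the line of [x] is orthogonal to [x]
    ([section_balanced]). In the plane this forces consecutive elements to
    enclose equal angles (the zonogon is regular), so that the plane section
    is closed under its reflections ([balanced_refl_closed]). Any two elements
    of [F] lie in such a plane, so [F] is closed under all of its reflections
    ([balanced_reflection_closed]).

    It remains to see that a finite reflection group permutes the vertices
    [T c] regularly. Fix a generic [c] and let the group be generated by the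
    reflections in the simple elements of [F]. It is transitive because, for
    generic [x], an element [g] maximizing [<g x, c>] puts [g x] in the chamber
    of [c] ([weyl_transitive]). It is free because a word in simple
    reflections that keeps every positive element positive can be shortened
    until it is empty ([word_positive_id]). *)

(** * Plane sections: balanced sets of unit vectors *)
Lemma seq_argmax (R : realDomainType) (T : eqType) (s : seq T) (f : T -> R) :
  s != [::] -> exists2 x, x \in s & forall y, y \in s -> f y <= f x.
Proof.
elim: s => // a s IHs _; case: (eqVneq s [::]) => [->|s_n0].
  by exists a; rewrite ?mem_head // => y; rewrite inE => /eqP->.
have [x xs xmax] := IHs s_n0; case: (leP (f x) (f a)) => [le_xa|lt_ax].
- exists a; rewrite ?mem_head // => y; rewrite inE => /predU1P[->//|ys].
  exact: le_trans (xmax _ ys) le_xa.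
- exists x; first by rewrite inE xs orbT.
  by move=> y; rewrite inE => /predU1P[->|/xmax//]; exact: ltW.
Qed.

Arguments seq_argmax {R T s} f.

Section Plane.
Context {R : realFieldType}.
Implicit Types (x y z u p q : R * R).

Definition dot2 x y : R := x.1 * y.1 + x.2 * y.2.
Definition det2 x y : R := x.1 * y.2 - x.2 * y.1.
Definition refl2 z u : R * R :=
  (u.1 - 2 * dot2 z u * z.1, u.2 - 2 * dot2 z u * z.2).

Lemma pair_eq2 x y : x.1 = y.1 -> x.2 = y.2 -> x = y.
Proof. by case: x y => [? ?] [? ?] /= -> ->. Qed.

(** The vector [x] and its quarter turn are an orthonormal frame, in which [dot2 x]
    and [det2 x] are the coordinates. *)
Lemma frame_eq x u v : dot2 x x = 1 ->
  dot2 x u = dot2 x v -> det2 x u = det2 x v -> u = v.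
Proof.
rewrite /dot2 /det2 => x1 E F; apply: pair_eq2.
- have h w : w.1 = x.1 * (x.1 * w.1 + x.2 * w.2) - x.2 * (x.1 * w.2 - x.2 * w.1)
    by transitivity ((x.1 * x.1 + x.2 * x.2) * w.1); [rewrite x1 mul1r | ring].
  by rewrite (h u) (h v) E F.
- have h w : w.2 = x.2 * (x.1 * w.1 + x.2 * w.2) + x.1 * (x.1 * w.2 - x.2 * w.1)
    by transitivity ((x.1 * x.1 + x.2 * x.2) * w.2); [rewrite x1 mul1r | ring].
  by rewrite (h u) (h v) E F.
Qed.

(** On the open upper half of the unit circle, a larger first coordinate means a
    smaller angle; the last inequality compares the angles by a determinant. *)
Lemma upper_half_order (a b a' b' : R) :
  a * a + b * b = 1 -> a' * a' + b' * b' = 1 -> 0 < b -> 0 < b' -> a' <= a ->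
  (a' = a /\ b' = b) \/ 0 < a * b' - b * a'.
Proof.
move=> e e' b0 b0'; rewrite le_eqVlt => /orP[/eqP aa|lt_a].
  left; split=> //; subst a'.
  have : (b' - b) * (b' + b) = 0 by lra.
  by move/eqP; rewrite mulf_eq0 => /orP[] /eqP; lra.
right; case: (lerP a' 0) => ha'; case: (ltP 0 a) => ha; try nra.
have [-> | ?] := eqVneq a 0; first by nra.
have : b' < b by nra.
nra.
have : b < b' by nra.
nra.
Qed.

(** The hypotheses say that [K] is the cotangent of half the angle with cosine [t]
    and sine [e], so that [K] determines the angle. *)
Lemma dot_det_unique (K t e t' e' : R) :
  t * t + e * e = 1 -> t' * t' + e' * e' = 1 -> 0 < e -> 0 < e' ->
  K * e = 1 + t -> K * e' = 1 + t' -> t = t' /\ e = e'.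
Proof.
have aux (u w : R) : u * u + w * w = 1 -> 0 < w -> K * w = 1 + u ->
    w = K * (1 - u) /\ u * (K * K + 1) = K * K - 1.
  move=> uw w0 Kw.
  have h : w = K * (1 - u).
    apply: (mulIf (lt0r_neq0 w0)); rewrite mulrAC Kw; lra.
  by split=> //; move: Kw; rewrite {1}h; lra.
move=> h h' e0 e0' k k'.
have [E1 E2] := aux _ _ h e0 k; have [E1' E2'] := aux _ _ h' e0' k'.
have K0 : K * K + 1 != 0 by apply: lt0r_neq0; nra.
have tt : t = t' by apply: (mulIf K0); rewrite E2 E2'.
by split=> //; rewrite E1 E1' tt.
Qed.

Section Closed.
Variable F : seq (R * R).
Hypothesis F_uniq : uniq F.
Hypothesis F_opp : forall x, x \in F -> - x \in F.
Hypothesis F_unit : forall x, x \in F -> dot2 x x = 1.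
Hypothesis F_bal :
  forall x, x \in F -> \sum_(y <- F | 0 < det2 x y) dot2 x y = 0.

(** By balance, the sum of the elements on the left of [x] is [K x] times the
    quarter turn of [x]. *)
Let K x : R := \sum_(y <- F | 0 < det2 x y) det2 x y.

Let unit_pair x y : x \in F -> y \in F ->
  dot2 x y * dot2 x y + det2 x y * det2 x y = 1.
Proof.
move=> /F_unit x1 /F_unit y1; rewrite -[RHS]mulr1 -{1}x1 -y1 /dot2 /det2; ring.
Qed.

Let halfsum x p : x \in F ->
  \sum_(y <- F | 0 < det2 x y) dot2 p y = det2 x p * K x.
Proof.
move=> xF.
transitivity (dot2 x p * (\sum_(y <- F | 0 < det2 x y) dot2 x y) + det2 x p * K x).
  rewrite /K [X in X + _]mulr_sumr [X in _ + X]mulr_sumr.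
  rewrite -big_split /=; apply: eq_bigr => y _.
  transitivity (dot2 x x * dot2 p y); first by rewrite F_unit ?mul1r.
  rewrite /dot2 /det2; ring.
by rewrite F_bal // mulr0 add0r.
Qed.

Let colinear x y : x \in F -> y \in F -> det2 x y = 0 -> y = x \/ y = - x.
Proof.
move=> xF yF d0; have := unit_pair _ _ xF yF; rewrite d0 mulr0 addr0 => /eqP.
rewrite -expr2 sqrf_eq1 => /orP[] /eqP h; [left|right].
- apply: (frame_eq x); rewrite ?F_unit // ?h ?d0 //.
  by rewrite /det2; ring.
- apply: (frame_eq x); rewrite ?F_unit // ?h ?d0 //.
  + by rewrite -(F_unit _ xF) /dot2 /=; ring.
  + by rewrite /det2 /=; ring.
Qed.

(** [y] is the next element of [F] after [x], counterclockwise. *)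
Definition consecutive x y := [/\ x \in F, y \in F, 0 < det2 x y &
  forall u, u \in F -> 0 < det2 x u -> u = y \/ 0 < det2 y u].

Let detC x y : det2 y x = - det2 x y.
Proof. by rewrite /det2; ring. Qed.
Let dotC2 x y : dot2 y x = dot2 x y.
Proof. by rewrite /dot2; ring. Qed.
Let detNr x y : det2 x (- y) = - det2 x y.
Proof. by rewrite /det2 /=; ring. Qed.
Let detNl x y : det2 (- x) y = - det2 x y.
Proof. by rewrite /det2 /=; ring. Qed.
Let detxx x : det2 x x = 0.
Proof. by rewrite /det2 /=; ring. Qed.

(** The predecessor of [x] is the element on its right that is closest to it. *)
Let prevP x y0 : x \in F -> y0 \in F -> 0 < det2 y0 x -> exists y, consecutive y x.
Proof.
move=> xF y0F d0.
have [|y] := @seq_argmax R _ [seq y <- F | 0 < det2 y x] (dot2 x).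
  by rewrite -has_filter; apply/hasP; exists y0.
rewrite mem_filter => /andP[dy yF] ymax; exists y; split=> // u uF du.
have [d|d|d] := ltgtP 0 (det2 x u); [by right| |].
- have dux : 0 < det2 u x by rewrite detC oppr_gt0.
  have le : dot2 x u <= dot2 x y by apply: ymax; rewrite mem_filter dux.
  have e1 : dot2 x y * dot2 x y + det2 y x * det2 y x = 1.
    by rewrite dotC2 unit_pair.
  have e2 : dot2 x u * dot2 x u + det2 u x * det2 u x = 1.
    by rewrite dotC2 unit_pair.
  have [[E1 E2]|lt] := upper_half_order _ _ _ _ e1 e2 dy dux le.
    have uy : u = y by apply: (frame_eq x); rewrite ?F_unit // detC E2 -detC.
    by move: du; rewrite uy detxx ltxx.
  have : dot2 x y * det2 u x - det2 y x * dot2 x u = - det2 y u * dot2 x x.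
    by rewrite /dot2 /det2; ring.
  by rewrite F_unit // mulr1 => E; move: lt; rewrite E oppr_gt0 ltNge (ltW du).
- have [->|uE] := colinear _ _ xF uF (esym d); first by left.
  by move: du; rewrite uE detNr oppr_gt0 ltNge (ltW dy).
Qed.

(** From [x] to the next element [y], the left half-plane loses [y] and gains
    [-x]. Pairing the resulting relation between the two half-plane sums with
    [x] and with [y] yields the same equation for [K x] and for [K y]. It makes
    the angle from [x] to [y] a function of [K], so all these angles agree. *)
Let consecutiveK x y : consecutive x y ->
  K x = K y /\ K y * det2 x y = 1 + dot2 x y.
Proof.
case=> xF yF dxy xy_next.
have yDx : y != - x.
  by apply/eqP => E; move: dxy; rewrite E detNr detxx oppr0 ltxx.
have step p : det2 y p * K y + dot2 p y = det2 x p * K x - dot2 p x.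
  rewrite -!halfsum //.
  have -> : \sum_(u <- F | 0 < det2 x u) dot2 p u =
            dot2 p y + \sum_(u <- F | (0 < det2 x u) && (u != y)) dot2 p u.
    rewrite -big_filter (bigD1_seq y) ?filter_uniq ?mem_filter ?dxy //=.
    by rewrite big_filter_cond.
  have -> : \sum_(u <- F | 0 < det2 y u) dot2 p u =
            dot2 p (- x) + \sum_(u <- F | (0 < det2 x u) && (u != y)) dot2 p u.
    rewrite -big_filter (bigD1_seq (- x)) ?filter_uniq //=; last first.
      by rewrite mem_filter F_opp // andbT detNr -detC.
    rewrite big_filter_cond; congr (_ + _); rewrite big_seq_cond [RHS]big_seq_cond.
    apply: eq_bigl => u; case uF: (u \in F) => //=.
    apply/andP/andP => [[dyu uDx]|[dxu uDy]].
    - have [d|d|d] := ltgtP 0 (det2 x u).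
      + by split=> //; apply: contraTneq dyu => ->; rewrite detxx ltxx.
      + have [||uE|] := xy_next (- u); rewrite ?F_opp ?detNr ?oppr_gt0 //.
          by move: dyu; rewrite -[u]opprK uE detNr detxx oppr0 ltxx.
        by rewrite ltNge (ltW dyu).
      + have [uE|uE] := colinear _ _ xF uF (esym d).
          by move: dyu; rewrite uE detC oppr_gt0 ltNge (ltW dxy).
        by rewrite uE eqxx in uDx.
    - have [uE|dyu] := xy_next u uF dxu; first by rewrite uE eqxx in uDy.
      split=> //; apply: contraTneq dxu => ->.
      by rewrite detNr detxx oppr0 ltxx.
  rewrite /dot2 /=; ring.
have ex := step x; have ey := step y.
rewrite detxx F_unit // in ex; rewrite detxx F_unit // in ey.
rewrite detC in ex.
have K2 : K y * det2 x y = 1 + dot2 x y by lra.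
rewrite dotC2 in ey.
split=> //; apply: (mulIf (lt0r_neq0 dxy)); rewrite K2; lra.
Qed.

Let K_opp x : K (- x) = K x.
Proof.
have FN : perm_eq F [seq - y | y <- F].
  apply: uniq_perm; rewrite ?(map_inj_uniq oppr_inj) //.
  move=> y; apply/idP/mapP => [yF|[u uF ->]]; last exact: F_opp.
  by exists (- y); rewrite ?F_opp ?opprK.
rewrite /K (perm_big _ FN) big_map.
by apply: eq_big => y; rewrite detNl detNr opprK.
Qed.

Let refl2_dot z u v : dot2 z z = 1 -> dot2 (refl2 z u) (refl2 z v) = dot2 u v.
Proof.
move=> z1; rewrite /refl2 /=.
transitivity (dot2 u v - 4 * dot2 z u * dot2 z v * (1 - dot2 z z)).
  by rewrite /dot2 /=; ring.
by rewrite z1 subrr mulr0 subr0.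
Qed.

Let refl2_det z u v : dot2 z z = 1 -> det2 (refl2 z u) (refl2 z v) = det2 v u.
Proof.
move=> z1; rewrite /refl2 /=.
transitivity (det2 u v - 2 * det2 u v * dot2 z z); first by rewrite /det2 /dot2 /=; ring.
rewrite z1 detC; ring.
Qed.

Let refl2_self z : dot2 z z = 1 -> refl2 z z = - z.
Proof. by move=> z1; rewrite /refl2 z1; apply: pair_eq2 => /=; ring. Qed.

Let refl2N z u : refl2 z (- u) = - refl2 z u.
Proof. by rewrite /refl2 /dot2; apply: pair_eq2 => /=; ring. Qed.

(** Take the first [u] counterclockwise after [z] whose mirror image is not in
    [F], or is there with another value of [K]. The claim holds for the
    predecessor [p] of [u], which may be [z] itself. Angles between consecutive
    elements are determined by [K], so the predecessor of the image of [p] lies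
    at the same angle from it as [u] from [p], and hence it is the image of [u]. *)
Let refl2_upper z u : z \in F -> u \in F -> 0 < det2 z u ->
  (refl2 z u \in F) && (K (refl2 z u) == K u).
Proof.
move=> zF uF du.
set ok := fun u => (refl2 z u \in F) && (K (refl2 z u) == K u).
suff: [seq u <- F | (0 < det2 z u) && ~~ ok u] == [::].
  by rewrite -[_ == _]negbK -has_filter => /hasPn /(_ u uF); rewrite /= du negbK.
move: u uF du => _ _ _; apply: contraT => bad_n0.
have [u] := seq_argmax (dot2 z) bad_n0.
rewrite mem_filter => /andP[/andP[du u_bad] uF] umax.
have z1 := F_unit _ zF.
have [p pu] := prevP _ _ uF zF du.
have [Kpu Kdet] := consecutiveK _ _ pu; case: pu => pF _ dpu pu_next.
have okp : ok p.
  have [d|d|d] := ltgtP 0 (det2 z p).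
  - have lt : dot2 z u < dot2 z p.
      rewrite ltNge; apply/negP => le.
      have [[E1 E2]|] := upper_half_order _ _ _ _
        (unit_pair _ _ zF uF) (unit_pair _ _ zF pF) du d le.
        by move: dpu; rewrite (frame_eq z p u) // detxx ltxx.
      have -> : dot2 z u * det2 z p - det2 z u * dot2 z p = - (det2 p u * dot2 z z).
        by rewrite /dot2 /det2; ring.
      by rewrite z1 mulr1 oppr_gt0 ltNge (ltW dpu).
    apply: contraTT lt => p_bad; rewrite -leNgt; apply: umax.
    by rewrite mem_filter d p_bad pF.
  - have [|zu|] := pu_next z zF; first by rewrite detC oppr_gt0.
      by move: du; rewrite zu detxx ltxx.
    by rewrite detC oppr_gt0 ltNge (ltW du).
  - have [->|pE] := colinear _ _ zF pF (esym d).
      by rewrite /ok refl2_self // F_opp // K_opp eqxx.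
    by move: dpu; rewrite pE detNl oppr_gt0 ltNge (ltW du).
have /andP[spF /eqP Ksp] := okp; set sp := refl2 z p in spF Ksp.
have [y0 y0F dy0] : exists2 y, y \in F & 0 < det2 y sp.
  have pick y : y \in F -> det2 y sp != 0 -> exists2 y, y \in F & 0 < det2 y sp.
    move=> yF; rewrite neq_lt => /orP[] h; last by exists y.
    by exists (- y); rewrite ?F_opp // detNl oppr_gt0.
  have [d|] := eqVneq (det2 p sp) 0; last exact: pick.
  apply: (pick u uF); have [->|->] := colinear _ _ pF spF d.
    by rewrite detC oppr_eq0 gt_eqF.
  by rewrite detNr detC opprK gt_eqF.
have [q qsp] := prevP _ _ spF y0F dy0.
have [Kq Kqdet] := consecutiveK _ _ qsp; case: qsp => qF _ dq _.
have [Et Ee] : dot2 q sp = dot2 p u /\ det2 q sp = det2 p u.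
  apply: (dot_det_unique (K u)); rewrite ?unit_pair //.
  by rewrite -Kpu -Ksp.
have qE : q = refl2 z u.
  apply: (frame_eq sp); first exact: F_unit.
  - by rewrite dotC2 Et refl2_dot.
  - by rewrite detC Ee refl2_det // detC.
by move: u_bad; rewrite /ok -qE qF /= Kq Ksp Kpu eqxx.
Qed.

Lemma balanced_refl_closed z u : z \in F -> u \in F -> refl2 z u \in F.
Proof.
move=> zF uF; have [d|d|d] := ltgtP 0 (det2 z u).
- by have /andP[] := refl2_upper _ _ zF uF d.
- rewrite -[u]opprK refl2N F_opp //.
  have /andP[] // : (refl2 z (- u) \in F) && (K (refl2 z (- u)) == K (- u)).
  by apply: refl2_upper; rewrite ?F_opp // detNr oppr_gt0.
- have z1 := F_unit _ zF.
  have [->|->] := colinear _ _ zF uF (esym d).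
    by rewrite refl2_self // F_opp.
  by rewrite refl2N refl2_self // opprK.
Qed.

End Closed.
End Plane.

(** * The inner product *)
Section DotProduct.
Context {R : realType} {d : nat}.
Implicit Types (u v x y z c : 'cV[R]_d).

Lemma dotE u v : dot u v = \sum_i u i 0 * v i 0.
Proof. by rewrite /dot mxE; apply: eq_bigr => i _; rewrite mxE. Qed.

Lemma dotC u v : dot u v = dot v u.
Proof. by rewrite !dotE; apply: eq_bigr => i _; rewrite mulrC. Qed.

Lemma dotDr u v w : dot u (v + w) = dot u v + dot u w.
Proof. by rewrite /dot mulmxDr mxE. Qed.

Lemma dotZr k u v : dot u (k *: v) = k * dot u v.
Proof. by rewrite /dot -scalemxAr mxE. Qed.

Lemma dotNr u v : dot u (- v) = - dot u v.
Proof. by rewrite -scaleN1r dotZr mulN1r. Qed.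

Lemma dot0r u : dot u 0 = 0.
Proof. by rewrite -(scale0r 0) dotZr mul0r. Qed.

Lemma dotDl u v w : dot (v + w) u = dot v u + dot w u.
Proof. by rewrite dotC dotDr !(dotC u). Qed.

Lemma dotZl k u v : dot (k *: v) u = k * dot v u.
Proof. by rewrite dotC dotZr dotC. Qed.

Lemma dotNl u v : dot (- v) u = - dot v u.
Proof. by rewrite dotC dotNr dotC. Qed.

Lemma dot0l u : dot 0 u = 0.
Proof. by rewrite dotC dot0r. Qed.

Definition dot_lin := (dotDl, dotDr, dotZl, dotZr, dotNl, dotNr).

Lemma dot_sumr (I : Type) (r : seq I) (P : pred I) (F : I -> 'cV[R]_d) u :
  dot u (\sum_(i <- r | P i) F i) = \sum_(i <- r | P i) dot u (F i).
Proof. exact: (big_morph (dot u) (dotDr u) (dot0r u)). Qed.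

Lemma dot_ge0 u : 0 <= dot u u.
Proof. by rewrite dotE sumr_ge0 // => i _; rewrite -expr2 sqr_ge0. Qed.

Lemma dot_eq0 u : (dot u u == 0) = (u == 0).
Proof.
apply/eqP/eqP => [|->]; last exact: dot0r.
rewrite dotE => /psumr_eq0P h; apply/matrixP => i j; rewrite (ord1 j) mxE.
apply/eqP; rewrite -sqrf_eq0 expr2; apply/eqP/h => // k _.
by rewrite -expr2 sqr_ge0.
Qed.

Lemma dot_gt0 u : u != 0 -> 0 < dot u u.
Proof. by move=> u0; rewrite lt_neqAle dot_ge0 andbT eq_sym dot_eq0. Qed.

Lemma enorm_sq u : enorm u ^+ 2 = dot u u.
Proof. by rewrite /enorm sqr_sqrtr // dot_ge0. Qed.

Lemma dot_orthogonal (g : 'M[R]_d) u v :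
  orthogonal_group g -> dot (g *m u) (g *m v) = dot u v.
Proof.
move=> g_orth; rewrite /dot trmx_mul -mulmxA (mulmxA g^T).
by rewrite (_ : g^T *m g = 1%:M) // mul1mx.
Qed.

Lemma reflectionE z u :
  reflection z *m u = u - (2 * dot z u / dot z z) *: z.
Proof.
rewrite /reflection mulmxBl mul1mx enorm_sq -scalemxAl -mulmxA.
rewrite [z^T *m u]mx11_scalar mul_mx_scalar scalerA -/(dot z u).
by congr (_ - _ *: _); ring.
Qed.

End DotProduct.

(** * Orthogonal matrices and reflections *)
Section Reflections.
Context {R : realType} {d : nat}.
Implicit Types (g h : 'M[R]_d) (x y z : 'cV[R]_d).

Lemma orthogonal_trl g : orthogonal_group g -> g *m g^T = 1%:M.
Proof. exact: mulmx1C. Qed.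

Lemma orthogonal_inv g : orthogonal_group g -> invmx g = g^T.
Proof.
move=> g1; have [gu _] := mulmx1_unit (orthogonal_trl g g1).
by rewrite -[LHS]mulmx1 -(orthogonal_trl g g1) mulKmx.
Qed.

Lemma orthogonal_mul g h :
  orthogonal_group g -> orthogonal_group h -> orthogonal_group (g *m h).
Proof.
move=> g1 h1; rewrite /orthogonal_group /= trmx_mul -mulmxA (mulmxA g^T).
by rewrite (_ : g^T *m g = 1%:M) // mul1mx.
Qed.

Lemma reflection_tr z : (reflection z)^T = reflection z.
Proof. by rewrite /reflection linearB linearZ /= trmx1 trmx_mul trmxK. Qed.

Lemma reflection_id z : z != 0 -> reflection z *m z = - z.
Proof.
move=> z0; rewrite reflectionE mulfK ?dot_eq0 // scaler_nat mulr2n.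
by rewrite opprD addrA subrr add0r.
Qed.

Lemma mx_ext (A B : 'M[R]_d) : (forall x, A *m x = B *m x) -> A = B.
Proof.
move=> h; apply/matrixP => i j; have /matrixP/(_ i 0) := h (delta_mx j 0).
by rewrite -!colE !mxE.
Qed.

Lemma reflectionK z : z != 0 -> reflection z *m reflection z = 1%:M.
Proof.
move=> z0; apply: mx_ext => x; rewrite mul1mx -mulmxA [X in _ *m X]reflectionE.
rewrite mulmxBr -scalemxAr reflection_id // reflectionE scalerN opprK.
by rewrite subrK.
Qed.

Lemma reflection_orthogonal z : z != 0 -> orthogonal_group (reflection z).
Proof. by move=> z0; rewrite /orthogonal_group /= reflection_tr reflectionK. Qed.

Lemma reflection_conj g z : orthogonal_group g ->
  reflection (g *m z) = g *m reflection z *m g^T.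
Proof.
move=> g1; rewrite /reflection !enorm_sq dot_orthogonal // mulmxBr mulmx1 mulmxBl.
rewrite orthogonal_trl // -scalemxAr -scalemxAl trmx_mul.
by rewrite !mulmxA.
Qed.

Lemma dot_adj g x y : dot (g *m x) y = dot x (g^T *m y).
Proof. by rewrite /dot trmx_mul mulmxA. Qed.

End Reflections.

(** * Zonotopes given by generators, and their faces *)
Section Zonotope.
Context {R : realType} {d : nat}.
Implicit Types (u v x y z c : 'cV[R]_d) (s : seq 'cV[R]_d).

Fixpoint zon s : set 'cV[R]_d :=
  if s is z :: s' then
    [set y | exists x t, [/\ zon s' x, -1 <= t <= 1 & y = x + t *: z]]
  else [set 0].

Lemma minkowski_zon (I : eqType) (r : seq I) (h : I -> 'cV[R]_d) : uniq r ->
  zon [seq h i | i <- r] = [set x | exists t : I -> R,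
    (forall i, -1 <= t i <= 1) /\ x = \sum_(i <- r) t i *: h i].
Proof.
elim: r => [_|a r IHr] /=.
  apply/seteqP; split=> [x /= ->|x /= [t [_ ->]]]; last by rewrite big_nil.
  by exists (fun=> 0); rewrite big_nil; split=> // i; lra.
case/andP => ar /IHr ->; apply/seteqP; split => x /=.
- case=> _ [k [[t [t01 ->]] k01 ->]].
  exists (fun i => if i == a then k else t i); split=> [i|].
    by case: ifP.
  rewrite big_cons eqxx addrC; congr (_ + _).
  by apply: eq_big_seq => i; case: eqVneq => // ->; rewrite (negPf ar).
- case=> t [t01 ->]; exists (\sum_(i <- r) t i *: h i), (t a); split=> //.
    by exists t.
  by rewrite big_cons addrC.
Qed.

Lemma zonotope_zon (P : set 'cV[R]_d) :
  zonotope P -> exists m s, P = [set m + x | x in zon s].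
Proof.
case=> _ [n [a [b ->]]].
exists (\sum_i 2^-1 *: (a i + b i)),
       [seq 2^-1 *: (b i - a i) | i <- index_enum 'I_n].
rewrite minkowski_zon ?index_enum_uniq //; apply/seteqP; split => x.
- case=> p [p_seg ->].
  have {p_seg}/choice [t tP] : forall i, exists t : R, (0 <= t <= 1) /\
      p i = (1 - t) *: a i + t *: b i.
    by move=> i; have [t /=] := p_seg i; rewrite in_itv /= => ? <-; exists t.
  exists (\sum_i (2 * t i - 1) *: (2^-1 *: (b i - a i))).
    exists (fun i => 2 * t i - 1); split=> // i.
    by have [+ _] := tP i => /andP[]; lra.
  rewrite -big_split /=; apply: eq_bigr => i _; have [_ ->] := tP i.
  by apply/matrixP => k l; rewrite !mxE; field.
- case=> _ [t [t01 ->]] <-.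
  exists (fun i => 2^-1 *: (a i + b i) + t i *: (2^-1 *: (b i - a i))).
  split; last by rewrite big_split.
  move=> i; exists ((1 + t i) / 2).
    by rewrite /= in_itv /=; have := t01 i => /andP[]; lra.
  by apply/matrixP => k l; rewrite !mxE; field.
Qed.

Lemma zon0 s : zon s 0.
Proof.
elim: s => //= z s IHs; exists 0, 0; split=> //; last by rewrite scale0r addr0.
by apply/andP; split; lra.
Qed.

Lemma zon_mem s z : z \in s -> zon s z.
Proof.
elim: s => //= y s IHs; rewrite inE => /predU1P[->|/IHs zs].
- exists 0, 1; split; first exact: zon0; last by rewrite scale1r add0r.
  by apply/andP; split; lra.
- exists z, 0; split=> //; last by rewrite scale0r addr0.
  by apply/andP; split; lra.
Qed.

Lemma zon_rem s z : z \in s -> zon s = zon (z :: rem z s).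
Proof.
have zon_cons y s1 s2 : zon s1 = zon s2 -> zon (y :: s1) = zon (y :: s2).
  by move=> /= ->.
have zon_swap y x s1 : zon (y :: x :: s1) `<=` zon (x :: y :: s1).
  move=> _ /= [_ [t [[w [k [ws1 k1 ->]]] t1 ->]]].
  exists (w + t *: y), k; split=> //; last by rewrite addrAC.
  by exists w, t.
elim: s => // y s IHs; rewrite inE /= => /predU1P[->|zs]; first by rewrite eqxx.
case: eqVneq => [->//|yz]; rewrite -/(zon (y :: s)) (zon_cons _ _ _ (IHs zs)).
by apply/seteqP; split; exact: zon_swap.
Qed.

Lemma zon_merge s z k : zon (k *: z :: z :: s) = zon ((1 + `|k|) *: z :: s).
Proof.
apply/seteqP; split=> x /=.
- case=> _ [t [[w [r [ws r1 ->]]] t1 ->]]; exists w, ((r + t * k) / (1 + `|k|)).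
  have k0 : 0 < 1 + `|k| by apply: ltr_wpDr.
  split=> //; last by rewrite !scalerA divfK ?gt_eqF // scalerDl addrA.
  have tk : `|t * k| <= `|k| by rewrite normrM ler_piMl // ler_norml.
  rewrite -ler_norml normrM normfV (gtr0_norm k0) ler_pdivrMr // mul1r.
  by apply: le_trans (ler_normD _ _) _; rewrite lerD // ler_norml.
- case=> w [t [ws t1 ->]]; exists (w + t *: z), (t * Num.sg k); split.
  + by exists w, t.
  + rewrite -!ler_norml in t1 *; rewrite normrM normr_sg.
    by case: (k != 0); rewrite /= ?mulr1 ?mulr0 // ler01.
  + rewrite !scalerA -addrA -scalerDl; congr (_ + _ *: _).
    by rewrite -mulrA -normrEsg; ring.
Qed.

(** The scalar [k] may be negative: a reduced list meets each line through the
    origin at most once. *)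
Definition reduced s := [/\ uniq s, 0 \notin s &
  forall x y k, x \in s -> y \in s -> x = k *: y -> x = y].

Lemma reduced_zon s : exists2 s', reduced s' & zon s' = zon s.
Proof.
elim: s => [|g s [s' [s'_uniq s'0 s'_red] zs']].
  by exists [::] => //; split.
have zE : zon (g :: s) = zon (g :: s') by rewrite /= zs'.
have [g0|g0] := eqVneq g 0.
  exists s'; rewrite ?zE //; apply/seteqP; split => x /=.
    by move=> xs; exists x, 0; split; rewrite ?scale0r ?addr0 //; lra.
  by case=> w [t [ws _ ->]]; rewrite g0 scaler0 addr0.
have [[z [k [zs gz]]]|no_par] := pselect (exists z k, z \in s' /\ g = k *: z).
- have k1 : 1 + `|k| != 0 by rewrite gt_eqF // ltr_wpDr.
  exists ((1 + `|k|) *: z :: rem z s'); last first.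
    by rewrite -zon_merge -gz zE [in RHS]/= (zon_rem _ _ zs).
  have z0 : z != 0 by apply: contraNneq s'0 => <-.
  have notz y : y \in rem z s' -> y != z /\ y \in s'.
    by rewrite mem_rem_uniq // inE => /andP.
  have par y k' : y \in s' -> y = k' *: z -> y = z by move=> ys; exact: s'_red.
  split=> [/=||x y k'].
  + rewrite rem_uniq // andbT; apply/negP => /notz[h hs].
    by rewrite (par _ _ hs erefl) eqxx in h.
  + rewrite inE negb_or eq_sym scaler_eq0 negb_or k1 z0.
    by apply/negP => /notz[_]; exact/negP.
  + rewrite !inE => /predU1P[->|xr] /predU1P[->//|yr].
    * have [yz ys] := notz _ yr => h.
      rewrite (par y ((1 + `|k|) / k')) ?eqxx // in yz.
      have k'0 : k' != 0.
        apply: contraNneq z0 => k'0; move/eqP: h.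
        by rewrite k'0 scale0r scaler_eq0 (negPf k1).
      by rewrite mulrC -scalerA h scalerA mulVf // scale1r.
    * have [xz xs] := notz _ xr; rewrite scalerA => /(par _ _ xs) h.
      by rewrite h eqxx in xz.
    * by have [[_ ys] [_ xs]] := (notz _ yr, notz _ xr); exact: s'_red.
- exists (g :: s') => //; split=> [/=||x y k].
  + rewrite s'_uniq andbT; apply/negP => gs.
    by apply: no_par; exists g, 1; rewrite scale1r.
  + by rewrite inE negb_or eq_sym g0.
  + rewrite !inE => /predU1P[->|xs] /predU1P[->//|ys] h.
    * by case: no_par; exists y, k.
    * have k0 : k != 0.
        by apply: contraNneq s'0 => k0; move: h; rewrite k0 scale0r => <-.
      case: no_par; exists x, k^-1; split=> //.
      by rewrite h scalerA mulVf // scale1r.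
    * exact: s'_red h.
Qed.


(** The centre of the face exposed by [c]: generators orthogonal to [c] get
    coefficient 0. *)
Definition apex c s := \sum_(z <- s) Num.sg (dot c z) *: z.

Lemma apex_cons c z s : apex c (z :: s) = apex c s + Num.sg (dot c z) *: z.
Proof. by rewrite /apex big_cons addrC. Qed.

Lemma interval_mul_le_norm (t a : R) : -1 <= t <= 1 ->
  t * a <= Num.sg a * a /\ (t * a = Num.sg a * a -> a = 0 \/ t = Num.sg a).
Proof.
case/andP => t1 t1'; have [a0|a0|->] := ltrgt0P a.
- rewrite gtr0_sg //; split; first by nra.
  by move/(mulIf (lt0r_neq0 a0)) => ->; right.
- rewrite ltr0_sg //; split; first by nra.
  by move/(mulIf (ltr0_neq0 a0)) => ->; right.
- by rewrite !mulr0; split=> //; left.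
Qed.

Lemma zon_le_apex c s x : zon s x -> dot c x <= dot c (apex c s).
Proof.
elim: s x => [|z s IHs] x /=; first by move=> ->; rewrite /apex big_nil.
case=> w [t [/IHs ws t1 ->]]; rewrite apex_cons !dot_lin lerD //.
by have [] := interval_mul_le_norm t (dot c z) t1.
Qed.

Lemma zon_max_apex c s x : zon s x -> dot c x = dot c (apex c s) ->
  exists2 w, zon [seq z <- s | dot c z == 0] w & x = apex c s + w.
Proof.
elim: s x => [|z s IHs] x /=.
  by move=> -> _; exists 0; rewrite // /apex big_nil addr0.
case=> w [t [ws t1 ->]]; rewrite apex_cons !dot_lin => E.
have le1 := zon_le_apex c s w ws.
have [le2 eq2] := interval_mul_le_norm t (dot c z) t1.
have [E1 E2] : dot c w = dot c (apex c s) /\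
    t * dot c z = Num.sg (dot c z) * dot c z by split; lra.
have [w' w's ->] := IHs w ws E1; case: eqVneq => [cz|cz].
- exists (w' + t *: z); last by rewrite cz sgr0 scale0r addr0 addrA.
  by exists w', t.
- exists w' => //; have [cz0|->] := eq2 E2; first by rewrite cz0 eqxx in cz.
  by rewrite addrAC.
Qed.

Lemma zon_apex_face c s w : zon [seq z <- s | dot c z == 0] w ->
  zon s (apex c s + w) /\ dot c w = 0.
Proof.
elim: s w => [|z s IHs] w /=.
  by move=> ->; rewrite /apex big_nil addr0 dot0r.
rewrite apex_cons; case: eqVneq => [cz /= [v [t [/IHs[vs v0] t1 ->]]]|cz /IHs[ws w0]].
- rewrite !dot_lin v0 cz mulr0 addr0; split=> //.
  rewrite sgr0 scale0r addr0; exists (apex c s + v), t.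
  by rewrite addrA; split.
- split=> //; exists (apex c s + w), (Num.sg (dot c z)); split=> //.
    by rewrite -ler_norml normr_sg; case: (_ != 0); rewrite ?ler01.
  by rewrite addrAC.
Qed.

(** A linear functional is maximal on a Minkowski sum when it is maximal on each
    summand: a generator not orthogonal to [c] is forced to one end of its
    segment, and the others are free. *)
Lemma zon_face c s :
  [set x | zon s x /\ forall y, zon s y -> dot c y <= dot c x] =
  [set apex c s + w | w in zon [seq z <- s | dot c z == 0]].
Proof.
apply/seteqP; split=> x /=.
- case=> xs xmax; have [apex_s _] := zon_apex_face c s 0 (zon0 _).
  rewrite addr0 in apex_s.
  have [w ws ->] : exists2 w, zon [seq z <- s | dot c z == 0] w & x = apex c s + w.
    apply: zon_max_apex => //; apply/le_anti; rewrite zon_le_apex //=.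
    exact: xmax.
  by exists w.
- case=> w /zon_apex_face[ws w0] <-; split=> // y /(zon_le_apex c).
  by rewrite dotDr w0 addr0.
Qed.
End Zonotope.

(** * Directions in general position *)
Section GenericDirections.
Context {R : realType} {d : nat}.
Implicit Types (a b c x y z e : 'cV[R]_d) (s F : seq 'cV[R]_d).

(** Steps bounded by [|<a, y>| / (1 + |<b, y>|)] do not cross the hyperplane
    orthogonal to [y], and there are only finitely many [y]. *)
Lemma perturb s a b : exists2 t : R, 0 < t & forall y r, y \in s ->
  dot a y != 0 -> `|r| <= t -> Num.sg (dot (a + r *: b) y) = Num.sg (dot a y).
Proof.
elim: s => [|y s [t t0 IHs]]; first by exists 1.
have [ay|ay] := eqVneq (dot a y) 0.
  exists t => // x r; rewrite inE => /predU1P[->|]; first by rewrite ay eqxx.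
  exact: IHs.
have b1 : 0 < 1 + `|dot b y| by rewrite ltr_wpDr.
exists (Num.min t (`|dot a y| / (1 + `|dot b y|))).
  by rewrite lt_min t0 divr_gt0 // normr_gt0.
move=> x r; rewrite inE le_min => /predU1P[->|xs] ax /andP[rt]; last first.
  by move=> _; exact: IHs.
rewrite ler_pdivlMr // => r_small; rewrite dotDl dotZl.
have {r_small} : `|r * dot b y| < `|dot a y|.
  have [->|r0] := eqVneq r 0; first by rewrite mul0r normr0 normr_gt0.
  apply: lt_le_trans r_small; rewrite normrM ltr_pM2l ?normr_gt0 //.
  by rewrite ltrDr.
move: (r * dot b y) => k; have [a0|a0|a0] := ltrgt0P (dot a y).
- rewrite ltr_norml => /andP[h _]; rewrite !gtr0_sg //; lra.
- rewrite ltr_norml => /andP[_ h]; rewrite !ltr0_sg //; lra.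
- by rewrite a0 eqxx in ay.
Qed.

(** A vector that works for all of [s] but one element is moved slightly, by
    [perturb], in a direction that works for that element. *)
Lemma generic_in_subspace (A : 'cV[R]_d -> Prop) s :
  A 0 -> (forall a b t, A a -> A b -> A (a + t *: b)) ->
  (forall y, y \in s -> exists2 a, A a & dot a y != 0) ->
  exists2 a, A a & forall y, y \in s -> dot a y != 0.
Proof.
move=> A0 A_lin; elim: s => [_|y s IHs hs]; first by exists 0.
have [x xs|a Aa a_gen] := IHs; first by apply: hs; rewrite inE xs orbT.
have [ay|ay] := eqVneq (dot a y) 0; last first.
  by exists a => // x; rewrite inE => /predU1P[->//|/a_gen].
have [b Ab by0] := hs y (mem_head _ _).
have [t t0 ht] := perturb s a b.
exists (a + t *: b); first exact: A_lin.
move=> x; rewrite inE => /predU1P[->|xs].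
  by rewrite dotDl dotZl ay add0r mulf_neq0 // gt_eqF.
by rewrite -sgr_eq0 ht ?a_gen ?sgr_eq0 ?a_gen // gtr0_norm.
Qed.

Lemma generic_perp z s : exists2 c, dot c z = 0 &
  forall y, y \in s -> (forall k, y != k *: z) -> dot c y != 0.
Proof.
pose res y := y - (dot z y / dot z z) *: z.
have resz y : dot (res y) z = 0.
  have [->|z0] := eqVneq z 0; first by rewrite dot0r.
  by rewrite /res !dot_lin (dotC y) divfK ?subrr // gt_eqF // dot_gt0.
have [||y|c cz c_gen] :=
  generic_in_subspace (fun c => dot c z = 0) [seq y <- s | res y != 0].
- exact: dot0l.
- by move=> a b t a0 b0; rewrite dotDl dotZl a0 b0 mulr0 addr0.
- rewrite mem_filter => /andP[ry _]; exists (res y); first exact: resz.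
  have -> : y = res y + (dot z y / dot z z) *: z by rewrite /res subrK.
  rewrite -/(res y).
  have -> : res (res y + (dot z y / dot z z) *: z) = res y.
    by rewrite /res subrK.
  by rewrite dotDr dotZr resz mulr0 addr0 dot_eq0.
- exists c => // y ys y_par; apply: c_gen; rewrite mem_filter ys andbT.
  by rewrite subr_eq0.
Qed.

Lemma generic_perp2 x e s : dot x e = 0 -> dot x x != 0 -> dot e e != 0 ->
  exists c, [/\ dot c x = 0, dot c e = 0 & forall y, y \in s ->
    y != (dot x y / dot x x) *: x + (dot e y / dot e e) *: e -> dot c y != 0].
Proof.
move=> xe x0 e0.
pose pr y := (dot x y / dot x x) *: x + (dot e y / dot e e) *: e.
have prx y : dot (y - pr y) x = 0.
  by rewrite /pr !dot_lin (dotC e x) xe mulr0 addr0 divfK // (dotC y) subrr.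
have pre y : dot (y - pr y) e = 0.
  by rewrite /pr !dot_lin xe mulr0 add0r divfK // (dotC y) subrr.
have [|||c [cx ce] c_gen] := generic_in_subspace
  (fun c => dot c x = 0 /\ dot c e = 0) [seq y <- s | y != pr y].
- by rewrite !dot0l.
- by move=> a b t [a0 a1] [b0 b1]; rewrite !dotDl !dotZl a0 b0 a1 b1 mulr0 addr0.
- move=> y; rewrite mem_filter -subr_eq0 => /andP[ry _].
  exists (y - pr y); first by split.
  rewrite -[y in dot _ y](subrK (pr y)) dotDr [X in _ + X]dotDr !dotZr prx pre.
  by rewrite !mulr0 !addr0 dot_eq0.
- exists c; split=> // y ys yE; apply: c_gen; rewrite mem_filter ys andbT.
  exact: yE.
Qed.

End GenericDirections.

(** * From balanced directions to closure under reflections *)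
Section Inscribed.
Context {R : realType} {d : nat}.
Implicit Types (a b c x y z e : 'cV[R]_d) (s F : seq 'cV[R]_d).

Definition pos_sum F c := \sum_(y <- F | 0 < dot c y) y.

Variables (F : seq 'cV[R]_d) (q : R).
Hypotheses (F_uniq : uniq F) (F_opp : forall x, x \in F -> - x \in F).
Hypothesis F_par : forall x y k, x \in F -> y \in F -> x = k *: y -> x = y \/ x = - y.
Hypotheses (q_gt0 : 0 < q) (F_norm : forall x, x \in F -> dot x x = q).
Hypothesis F_bal : forall x c, x \in F -> dot c x = 0 ->
  (forall y, y \in F -> dot c y = 0 -> y = x \/ y = - x) ->
  dot (pos_sum F c) x = 0.

Lemma perm_opp : perm_eq F [seq - y | y <- F].
Proof.
apply: uniq_perm; rewrite ?(map_inj_uniq oppr_inj) //.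
move=> y; apply/idP/mapP => [yF|[u uF ->]]; last exact: F_opp.
by exists (- y); rewrite ?F_opp ?opprK.
Qed.

Let q_neq0 : q != 0. Proof. by rewrite gt_eqF. Qed.

(** The plane is spanned by [x] in [F] and [e], orthogonal and of equal norm. In
    the coordinates [co] relative to this basis the elements of [F] in the
    plane become unit vectors. *)
Section PlaneSection.
Variables (x e : 'cV[R]_d).
Hypotheses (xF : x \in F) (xe : dot x e = 0) (ee : dot e e = q).

Let xx : dot x x = q. Proof. exact: F_norm. Qed.
Let ex : dot e x = 0. Proof. by rewrite dotC. Qed.

Let co y := (dot x y / q, dot e y / q).
Let vec (p : R * R) := p.1 *: x + p.2 *: e.
Let inL y := y == vec (co y).

Let vecK p : co (vec p) = p.
Proof.
case: p => a b; rewrite /co /vec /= !dot_lin xx ee xe ex !mulr0 addr0 add0r.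
by rewrite !mulfK.
Qed.

Let dot_vec p y : dot (vec p) y = q * dot2 p (co y).
Proof. by rewrite /vec /dot2 /co !dot_lin /=; field. Qed.

(** Choose [c] orthogonal to the plane and generic otherwise, and let [J] be the
    quarter turn of [z] in the plane. Replacing [c + t J] by [c - t J] leaves the
    contribution of the elements off the plane unchanged and negates that of the
    elements in the plane. Both totals are orthogonal to [z], hence so is the
    contribution of the plane. *)
Let section_balanced z : z \in F -> inL z ->
  \sum_(y <- F | inL y && (0 < det2 (co z) (co y))) dot2 (co z) (co y) = 0.
Proof.
move=> zF /eqP zL.
pose J := vec (- (co z).2, (co z).1).
have dotJ y : dot J y = q * det2 (co z) (co y).
  by rewrite dot_vec /dot2 /det2 /=; ring.
have Jpos y : (0 < det2 (co z) (co y)) = (0 < dot J y) by rewrite dotJ pmulr_rgt0.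
have dotz y : dot z y = q * dot2 (co z) (co y) by rewrite {1}zL dot_vec.
have zz : dot2 (co z) (co z) = 1.
  by apply: (mulfI q_neq0); rewrite -dotz F_norm // mulr1.
have [c [cx ce c_gen]] : exists c, [/\ dot c x = 0, dot c e = 0 &
    forall y, y \in F -> ~~ inL y -> dot c y != 0].
  have [||c [cx ce c_gen]] := @generic_perp2 R d x e F xe.
  + by rewrite xx.
  + by rewrite ee.
  exists c; split=> // y yF yL; apply: c_gen => //.
  by rewrite xx ee.
have cL y : inL y -> dot c y = 0.
  by move=> /eqP->; rewrite /vec !dot_lin cx ce !mulr0 addr0.
have [t t0 ht] := perturb F c J.
pose side r := \sum_(y <- F | inL y && (0 < r * dot J y)) dot z y.
pose off := \sum_(y <- F | ~~ inL y && (0 < dot c y)) dot z y.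
(* [c + r J] is orthogonal to no element of [F] other than [z] and [-z]. *)
have bal r : `|r| <= t -> r != 0 -> side r + off = 0.
  move=> rt r0; rewrite -(F_bal z (c + r *: J) zF).
  - rewrite dotC /pos_sum dot_sumr (bigID inL) /=; congr (_ + _).
      apply: eq_bigl => y; rewrite andbC; case yL: (inL y); rewrite ?andbF //.
      by rewrite dotDl dotZl cL // add0r.
    rewrite /off big_seq_cond [RHS]big_seq_cond; apply: eq_bigl => y.
    case yF: (y \in F) => //=; rewrite andbC.
    case yL: (inL y); rewrite ?andbF ?andbT //=.
    by rewrite -sgr_gt0 -(ht y r) ?sgr_gt0 ?c_gen ?yL.
  - rewrite dotDl dotZl (cL z) ?add0r; last exact/eqP.
    by rewrite dotJ /det2 mulrC [_.2 * _]mulrC subrr mulr0 mul0r.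
  - move=> y yF cy0; have [yL|yL] := boolP (inL y); last first.
      have := ht y r yF (c_gen y yF yL) rt; rewrite cy0 sgr0 => /esym/eqP.
      by rewrite sgr_eq0 (negPf (c_gen y yF yL)).
    move/eqP: cy0; rewrite dotDl dotZl cL // add0r mulf_eq0 (negPf r0) /= dotJ.
    rewrite mulf_eq0 (negPf q_neq0) /= => /eqP det0.
    apply: (F_par _ _ (dot2 (co z) (co y)) yF zF).
    rewrite (eqP yL) {2}zL vecK /vec scalerDr !scalerA.
    move: zz det0; rewrite /dot2 /det2; 
    case: (co z) (co y) => [a b] [a' b'] /= zz det0.
    have Ea : (a * a' + b * b') * a = a'.
      transitivity (a' * (a * a + b * b) + b * (a * b' - b * a')); first by ring.
      by rewrite zz det0; ring.
    have Eb : (a * a' + b * b') * b = b'.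
      transitivity (b' * (a * a + b * b) - a * (a * b' - b * a')); first by ring.
      by rewrite zz det0; ring.
    by rewrite Ea Eb.
have sideN r : side (- r) = - side r.
  rewrite /side (perm_big _ perm_opp) big_map -sumrN.
  apply: eq_big => y; last by move=> _; rewrite dotNr.
  rewrite dotNr mulrNN; congr (_ && _).
  by rewrite /inL /co /vec !dotNr !mulNr /= !scaleNr -opprD eqr_opp.
have st : side t = 0.
  have h1 : side t + off = 0 by apply: bal; rewrite ?gtr0_norm ?gt_eqF.
  have h2 : - side t + off = 0.
    by rewrite -sideN; apply: bal; rewrite ?normrN ?gtr0_norm ?oppr_eq0 ?gt_eqF.
  lra.
apply: (mulfI q_neq0); rewrite mulr0 -[RHS]st /side mulr_sumr.
by apply: eq_big => y; rewrite ?dotz // Jpos pmulr_rgt0.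
Qed.

Lemma plane_refl_closed y : y \in F -> inL y -> reflection x *m y \in F.
Proof.
move=> yF yL; pose L := [seq y <- F | inL y].
have memL z : (z \in L) = (inL z && (z \in F)) by rewrite mem_filter.
have xL : inL x by rewrite /inL /vec /co /= xx ex mul0r divff // scale1r scale0r addr0.
have coN z : co (- z) = - co z by rewrite /co !dotNr !mulNr.
have vecN p : vec (- p) = - vec p by rewrite /vec /= !scaleNr opprD.
have LN z : z \in L -> - z \in L.
  by rewrite !memL /inL coN vecN eqr_opp => /andP[-> /F_opp->].
have vec_co z : z \in L -> vec (co z) = z by rewrite memL => /andP[/eqP<-].
have coordsN p : p \in [seq co z | z <- L] -> - p \in [seq co z | z <- L].
  by case/mapP => z zL ->; rewrite -coN map_f // LN.
have coords_unit p : p \in [seq co z | z <- L] -> dot2 p p = 1.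
  case/mapP => z zL ->; apply: (mulfI q_neq0).
  by rewrite -dot_vec vec_co // F_norm ?mulr1 //; move: zL; rewrite memL => /andP[].
have coords_bal p : p \in [seq co z | z <- L] ->
    \sum_(p' <- [seq co z | z <- L] | 0 < det2 p p') dot2 p p' = 0.
  case/mapP => z; rewrite memL => /andP[zL zF] ->.
  by rewrite big_map big_filter_cond section_balanced.
have coords_uniq : uniq [seq co z | z <- L].
  rewrite map_inj_in_uniq ?filter_uniq // => z z' zL z'L E.
  by rewrite -(vec_co z zL) E vec_co.
have : refl2 (co x) (co y) \in [seq co z | z <- L].
  by apply: balanced_refl_closed => //; rewrite map_f // memL ?xL ?xF ?yL ?yF.
case/mapP => z zL zE; suff -> : reflection x *m y = z.
  by move: zL; rewrite memL => /andP[].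
rewrite -(vec_co z zL) -zE reflectionE {1}(eqP yL) /refl2 /dot2 /vec /co /= xx ex.
rewrite mul0r divff // addrAC -scalerBl.
congr (_ *: _ + _ *: _); field; exact: q_neq0.
Qed.
End PlaneSection.

(** If [y] is not parallel to [x], rescale the component of [y] orthogonal to [x]
    to the norm of [x] and use the plane spanned by the two. *)
Lemma balanced_reflection_closed x y : x \in F -> y \in F -> reflection x *m y \in F.
Proof.
move=> xF yF; pose r := y - (dot x y / q) *: x.
have rx : dot x r = 0.
  by rewrite /r !dot_lin F_norm // divfK ?subrr.
have yr : y = (dot x y / q) *: x + r by rewrite /r addrC subrK.
have [r0|r0] := eqVneq r 0.
  rewrite r0 addr0 in yr.
  have xrefl : reflection x *m x = - x.
    by apply: reflection_id; rewrite -dot_eq0 F_norm.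
  by have [->|->] := F_par _ _ _ yF xF yr;
    rewrite ?mulmxN xrefl ?opprK // F_opp.
have rr := dot_gt0 _ r0.
pose k := Num.sqrt (q / dot r r).
have kk : k * k * dot r r = q.
  by rewrite -expr2 sqr_sqrtr ?divfK ?gt_eqF // divr_ge0 // ltW.
have k0 : k != 0 by apply: contraTneq q_gt0 => k0; rewrite -kk k0 !mul0r ltxx.
apply: (plane_refl_closed x (k *: r)) => //.
- by rewrite dotZr rx mulr0.
- by rewrite dotZr dotZl mulrA.
- rewrite [X in _ == X](_ : _ = y) //= [RHS]yr; congr (_ + _).
  rewrite scalerA -[RHS]scale1r; congr (_ *: _).
  rewrite dotZl [y in dot _ y]yr dotDr dotZr (dotC r x) rx mulr0 add0r -kk.
  by field; rewrite dot_eq0 r0 k0.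
Qed.
End Inscribed.

(** * The reflection group of a root system *)
Section ReflectionGroup.
Context {R : realType} {d : nat}.
Implicit Types (a b c x y z e : 'cV[R]_d) (g h : 'M[R]_d) (r : seq 'cV[R]_d).
Variables (F : seq 'cV[R]_d) (q : R).
Hypotheses (F_uniq : uniq F) (F_opp : forall x, x \in F -> - x \in F).
Hypotheses (q_gt0 : 0 < q) (F_norm : forall x, x \in F -> dot x x = q).
Hypothesis F_refl : forall x y, x \in F -> y \in F -> reflection x *m y \in F.
Hypothesis F_span : forall x, (forall y, y \in F -> dot x y = 0) -> x = 0.
Variable c : 'cV[R]_d.

Definition generic x := forall y, y \in F -> dot x y != 0.
Hypothesis c_gen : generic c.

Let F_neq0 x : x \in F -> x != 0.
Proof. by move=> /F_norm h; rewrite -dot_eq0 h gt_eqF. Qed.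

(** The simple roots, whose hyperplanes are the walls of the chamber of [c]. They
    are usually defined as the indecomposable positive roots; the property
    chosen here is the one that the exchange argument uses. *)
Definition simples := [seq a <- F | (0 < dot c a) &&
  all (fun y => (0 < dot c y) && (y != a) ==> (0 < dot c (reflection a *m y))) F].

Lemma simplesP a : a \in simples -> [/\ a \in F, 0 < dot c a &
  forall y, y \in F -> 0 < dot c y -> y != a -> 0 < dot c (reflection a *m y)].
Proof.
rewrite mem_filter => /andP[/andP[a0 /allP h] aF]; split=> // y yF y0 ya.
by have /implyP := h y yF; apply; rewrite y0.
Qed.

Let simpleF a : a \in simples -> a \in F.
Proof. by case/simplesP. Qed.

(** The simple elements span the cone of positive elements, in dual form. If a
    positive [a] is not simple, then [a] is a positive multiple of [y + y'] for
    positive elements [y] and [y'], where [y'] is minus the reflection of [y] in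
    [a]. The map [y |-> - <x, y> / <c, y>] sends [a] to a weighted average of
    its values at [y] and [y'], so if [a] maximizes it then so do both of them.
    Since [y + y' = k a] with [k < 2], one of the two has a smaller inner product
    with [c] than [a]. Hence the maximizer of least inner product with [c] is
    simple. *)
Lemma simple_neg x z : z \in F -> 0 < dot c z -> dot x z < 0 ->
  exists2 a, a \in simples & dot x a < 0.
Proof.
move=> zF z0 xz; pose f y := - dot x y / dot c y.
have memP y : (y \in [seq y <- F | 0 < dot c y]) = (0 < dot c y) && (y \in F).
  by rewrite mem_filter.
have [|m] := seq_argmax (s := [seq y <- F | 0 < dot c y]) f.
  by rewrite -has_filter; apply/hasP; exists z.
rewrite memP => /andP[m0 mF] fmax.
have le_f y : y \in F -> 0 < dot c y -> - dot x y <= f m * dot c y.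
  by move=> yF y0; rewrite -ler_pdivrMr //; apply: fmax; rewrite memP y0.
have fm : 0 < f m.
  have := le_f z zF z0; rewrite -(pmulr_lgt0 _ z0); lra.
pose tie y := (0 < dot c y) && (- dot x y == f m * dot c y).
have [|a] := seq_argmax (s := [seq y <- F | tie y]) (fun y => - dot c y).
  rewrite -has_filter; apply/hasP; exists m => //.
  by rewrite /tie m0; apply/eqP; rewrite /f divfK // gt_eqF.
rewrite mem_filter => /andP[/andP[a0 /eqP xa] aF] amin; exists a; last first.
  by rewrite -oppr_gt0 xa mulr_gt0.
rewrite mem_filter a0 aF andbT /=; apply/allP => y yF; apply/implyP => /andP[y0 ya].
apply: contraT; rewrite -leNgt => y'_neg.
pose y' := - (reflection a *m y).
have y'F : y' \in F by rewrite F_opp // F_refl.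
have y'0 : 0 < dot c y'.
  by rewrite lt_neqAle eq_sym c_gen // dotNr oppr_ge0.
pose k := 2 * dot a y / q.
have sumE v : dot v y + dot v y' = k * dot v a.
  by rewrite /y' reflectionE F_norm // !dot_lin -/k; ring.
have k2 : k < 2.
  rewrite /k ltr_pdivrMr // ltr_pM2l //.
  have : 0 < dot (y - a) (y - a) by rewrite dot_gt0 // subr_eq0.
  by rewrite !dot_lin !F_norm // (dotC y a); lra.
have ley := le_f y yF y0; have ley' := le_f y' y'F y'0.
have sx := sumE x; have sc := sumE c.
have fsum : f m * dot c y + f m * dot c y' = k * (f m * dot c a).
  by rewrite -mulrDr sc; ring.
have xsum : k * dot x a = - (k * (f m * dot c a)) by rewrite -xa; ring.
have tie_y : dot c a <= dot c y.
  have := amin y; rewrite lerN2; apply; rewrite mem_filter yF /tie y0 /= andbT.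
  by apply/eqP; lra.
have tie_y' : dot c a <= dot c y'.
  have := amin y'; rewrite lerN2; apply; rewrite mem_filter y'F /tie y'0 /= andbT.
  by apply/eqP; lra.
have : k * dot c a < 2 * dot c a by rewrite ltr_pM2r.
lra.
Qed.

Definition word r : 'M[R]_d := foldr (fun a g => reflection a *m g) 1%:M r.

Lemma word_cat r1 r2 : word (r1 ++ r2) = word r1 *m word r2.
Proof. by elim: r1 => [|a r1 IH] /=; rewrite ?mul1mx // IH mulmxA. Qed.

Lemma word_rev r : word (rev r) = (word r)^T.
Proof.
elim: r => [|a r IH]; first by rewrite /= trmx1.
by rewrite rev_cons -cats1 word_cat IH /= mulmx1 trmx_mul reflection_tr.
Qed.

Lemma word_orthogonal r : {subset r <= F} -> orthogonal_group (word r).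
Proof.
elim: r => [_|a r IH h]; first by rewrite /orthogonal_group /= trmx1 mul1mx.
apply: orthogonal_mul; last by apply: IH => b br; apply: h; rewrite inE br orbT.
by apply/reflection_orthogonal/F_neq0/h/mem_head.
Qed.

Lemma word_F r y : {subset r <= F} -> y \in F -> word r *m y \in F.
Proof.
elim: r => [_|a r IH h yF] /=; first by rewrite mul1mx.
rewrite -mulmxA; apply: F_refl; first exact/h/mem_head.
by apply: IH => // b br; apply: h; rewrite inE br orbT.
Qed.

(** Apply the letters of [r] one by one to [a], from the right: the letter that
    first makes the image negative is, by simplicity, that image itself. *)
Lemma exchange r a : {subset r <= simples} -> a \in F -> 0 < dot c a ->
  dot c (word r *m a) < 0 ->
  exists r1 b r2, r = r1 ++ b :: r2 /\ word r2 *m a = b.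
Proof.
elim: r => [_ aF a0|b r IH h aF a0] /=; first by rewrite mul1mx ltNge ltW.
have rS : {subset r <= simples} by move=> x xr; apply: h; rewrite inE xr orbT.
rewrite -mulmxA; set y := word r *m a => yneg.
have yF : y \in F by apply: word_F => // x /rS/simpleF.
have [y0|y0|] := ltrgt0P (dot c y); last by move/eqP; rewrite (negPf (c_gen _ yF)).
- exists [::], b, r; split=> //; apply/eqP; apply: contraLR yneg => yb.
  have [_ _ bS] := simplesP b (h b (mem_head _ _)).
  by rewrite -leNgt ltW // bS.
- have [r1 [b' [r2 [-> E]]]] := IH rS aF a0 y0.
  by exists (b :: r1), b', r2.
Qed.

(** Deletion: if the word is not empty, its last letter [a] is sent to a negative
    element by the letters before it. By exchange, some letter [b] is the image
    of [a] under the letters between them, so that its reflection is a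
    conjugate of that of [a], and both letters cancel. *)
Lemma word_positive_id r : {subset r <= simples} ->
  (forall y, y \in F -> 0 < dot c y -> 0 < dot c (word r *m y)) ->
  word r = 1%:M.
Proof.
have [n] := ubnP (size r); elim: n r => // n IHn r.
case/lastP: r => [//|r a]; rewrite size_rcons ltnS => lt_rn rS r_pos.
have aS : a \in simples by apply: rS; rewrite mem_rcons mem_head.
have r'S : {subset r <= simples}.
  by move=> x xr; apply: rS; rewrite mem_rcons inE xr orbT.
have [aF a0 _] := simplesP a aS.
have wE : word (rcons r a) = word r *m reflection a.
  by rewrite -cats1 word_cat /= mulmx1.
have ra : dot c (word r *m a) < 0.
  have := r_pos a aF a0; rewrite wE -mulmxA reflection_id ?F_neq0 //.
  by rewrite mulmxN dotNr oppr_gt0.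
have [r1 [b [r2 [rE bE]]]] := exchange r a r'S aF a0 ra.
have r2F : {subset r2 <= F}.
  by move=> x xr; apply/simpleF/r'S; rewrite rE mem_cat inE xr !orbT.
have shorter : word (rcons r a) = word (r1 ++ r2).
  rewrite wE rE !word_cat /= -bE reflection_conj; last exact: word_orthogonal.
  rewrite -!mulmxA (mulmxA _^T) (_ : _^T *m _ = 1%:M); last exact: word_orthogonal.
  by rewrite mul1mx reflectionK ?F_neq0 // mulmx1.
rewrite shorter; apply: IHn.
- by move: lt_rn; rewrite rE !size_cat /= addnS => /ltnW.
- move=> x; rewrite mem_cat => xr; apply: r'S; rewrite rE mem_cat inE.
  by case/orP: xr => ->; rewrite ?orbT.
- by move=> y yF y0; rewrite -shorter r_pos.
Qed.

Definition weyl : set 'M[R]_d := smallest (@orthogonal_subgroup R d)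
  [set reflection x | x in [set` simples]].

Lemma weylE : weyl =
  [set word r | r in [set r : seq 'cV[R]_d | {subset r <= simples}]].
Proof.
have subF r : {subset r <= simples} -> {subset r <= F}.
  by move=> h x /h/simpleF.
apply/seteqP; split=> [g|_ [r /= rS <-] G [[_ G1 GM _] GS]].
- apply; split.
    split.
    + by move=> _ [r /= /subF rF <-]; exact: word_orthogonal.
    + by exists [::].
    + move=> _ _ [r1 /= r1S <-] [r2 /= r2S <-]; exists (r1 ++ r2).
        by move=> x; rewrite mem_cat => /orP[/r1S|/r2S].
      by rewrite word_cat.
    + move=> _ [r /= rS <-]; exists (rev r).
        by move=> x; rewrite mem_rev => /rS.
      by rewrite word_rev orthogonal_inv //; exact/word_orthogonal/subF.
  move=> _ [a /= aS <-]; exists [:: a]; last by rewrite /= mulmx1.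
  by move=> x; rewrite inE => /eqP->.
- elim: r rS => [_|a r IH rS] //=; apply: GM.
    by apply: GS; exists a => //=; apply: rS; exact: mem_head.
  by apply: IH => x xr; apply: rS; rewrite inE xr orbT.
Qed.

Lemma weyl1 : weyl 1%:M.
Proof. by rewrite weylE; exists [::]. Qed.

Lemma weylM g h : weyl g -> weyl h -> weyl (g *m h).
Proof.
rewrite weylE => -[r1 /= r1S <-] [r2 /= r2S <-]; exists (r1 ++ r2).
  by move=> x; rewrite mem_cat => /orP[/r1S|/r2S].
by rewrite word_cat.
Qed.

Lemma weyl_tr g : weyl g -> weyl g^T.
Proof.
rewrite weylE => -[r /= rS <-]; exists (rev r); last exact: word_rev.
by move=> x; rewrite mem_rev => /rS.
Qed.

Lemma weyl_simple a : a \in simples -> weyl (reflection a).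
Proof.
move=> aS; rewrite weylE; exists [:: a]; last by rewrite /= mulmx1.
by move=> x; rewrite inE => /eqP->.
Qed.

Lemma weyl_orthogonal g : weyl g -> orthogonal_group g.
Proof.
by rewrite weylE => -[r /= rS <-]; apply: word_orthogonal => x /rS/simpleF.
Qed.

Lemma weylF g y : weyl g -> y \in F -> g *m y \in F.
Proof. by rewrite weylE => -[r /= rS <-]; apply: word_F => x /rS/simpleF. Qed.

(** As [F] spans the space, an element of the group is determined by the
    permutation of [F] that it induces. *)
Lemma weyl_finite : finite_set weyl.
Proof.
pose mat (f : {ffun seq_sub F -> seq_sub F}) : 'M[R]_d :=
  xget 0 [set g | forall y : seq_sub F, g *m ssval y = ssval (f y)].
apply: (@sub_finite_set _ _ (mat @` [set: {ffun seq_sub F -> seq_sub F}])).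
  move=> g Gg.
  pose f : {ffun seq_sub F -> seq_sub F} :=
    [ffun y => SeqSub (weylF g _ Gg (ssvalP y))].
  exists f => //; rewrite /mat; case: xgetP => [h _ hf|/(_ g)[] y]; last by rewrite ffunE.
  have hg y : y \in F -> h *m y = g *m y.
    by move=> yF; have := hf (SeqSub yF); rewrite ffunE /=.
  apply: trmx_inj; apply: mx_ext => x; apply/eqP; rewrite -subr_eq0; apply/eqP.
  apply: F_span => y yF; rewrite dotDl dotNl !dot_adj !trmxK hg //.
  by rewrite subrr.
exact/finite_image/finite_finset.
Qed.

Lemma pos_sum_weyl g x : weyl g ->
  pos_sum F (g *m x) = g *m pos_sum F x.
Proof.
move=> Gg; have g1 := weyl_orthogonal g Gg.
have Fg : perm_eq F [seq g *m y | y <- F].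
  apply: uniq_perm => //.
    rewrite map_inj_uniq // => y z E.
    by rewrite -[y]mul1mx -[z]mul1mx -g1 -!mulmxA E.
  move=> y; apply/idP/mapP => [yF|[z zF ->]]; last exact: weylF.
  exists (g^T *m y); first by apply: weylF => //; exact: weyl_tr.
  by rewrite mulmxA orthogonal_trl // mul1mx.
rewrite /pos_sum (perm_big _ Fg) big_map mulmx_sumr.
by apply: eq_bigl => y; rewrite dot_orthogonal.
Qed.

Lemma weyl_generic g x : weyl g -> generic x -> generic (g *m x).
Proof.
by move=> Gg x_gen y yF; rewrite dot_adj x_gen // weylF //; exact: weyl_tr.
Qed.

(** The difference of the inner products of [x] with the two sums is a sum of
    terms [|<x, y>|], over the [y] on which the signs differ. *)
Lemma pos_sum_inj x x' y : generic x -> generic x' ->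
  pos_sum F x = pos_sum F x' -> y \in F -> (0 < dot x y) = (0 < dot x' y).
Proof.
move=> x_gen x'_gen E yF.
pose t y := (if 0 < dot x y then dot x y else 0) -
            (if 0 < dot x' y then dot x y else 0).
have t_ge0 z : true -> 0 <= t z.
  rewrite /t; case: (ltP 0 (dot x z)) => xz; case: ifP => _; lra.
have : \sum_(y <- F) t y = 0.
  rewrite sumrB -!big_mkcond /= -!dot_sumr -/(pos_sum F x) E.
  by rewrite -/(pos_sum F x') subrr.
move/eqP; rewrite psumr_eq0 // => /allP/(_ y yF)/= /eqP; rewrite /t.
have := x_gen y yF.
by case: (ltP 0 (dot x y)) => xy; case: ifP => _ // xy0 h; move/eqP: xy0; lra.
Qed.

(** If [<g x, c>] is maximal, then no reflection in a simple [a] increases it, so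
    [<g x, a> >= 0]; by [simple_neg], [g x] is then on the positive side of
    every positive element. *)
Lemma weyl_transitive x : generic x ->
  exists2 g, weyl g & g *m pos_sum F x = pos_sum F c.
Proof.
move=> x_gen; have /finite_seqP[l lE] := weyl_finite.
have memG g : weyl g <-> g \in l by rewrite lE.
have [|g gl gmax] := seq_argmax (s := l) (fun g => dot (g *m x) c).
  by apply/eqP => l0; have /memG := weyl1; rewrite l0.
have Gg : weyl g by apply/memG.
exists g => //; rewrite -pos_sum_weyl //.
have gx_gen := weyl_generic g x Gg x_gen.
have gx_simple a : a \in simples -> 0 <= dot (g *m x) a.
  move=> aS; have [aF a0 _] := simplesP a aS.
  have /gmax : reflection a *m g \in l.
    by apply/memG; apply: weylM => //; exact: weyl_simple.
  rewrite -mulmxA reflectionE F_norm // !dot_lin gerBl (dotC a c).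
  by rewrite pmulr_lge0 // pmulr_lge0 ?invr_gt0 // pmulr_rge0 // dotC.
have gx_pos y : y \in F -> 0 < dot c y -> 0 < dot (g *m x) y.
  move=> yF y0; rewrite lt_neqAle eq_sym gx_gen //= leNgt; apply/negP => h.
  have [a aS] := simple_neg _ y yF y0 h.
  by rewrite ltNge gx_simple.
rewrite /pos_sum big_seq_cond [RHS]big_seq_cond; apply: eq_bigl => y.
case yF: (y \in F) => //=; apply/idP/idP => [h|]; last exact: gx_pos.
rewrite lt_neqAle eq_sym c_gen //= leNgt; apply/negP => y0.
have := gx_pos (- y) (F_opp y yF); rewrite !dotNr !oppr_gt0 => /(_ y0).
by rewrite ltNge ltW.
Qed.

(** By transitivity it is enough to consider the stabilizer of the vertex given by
    [c]. Its elements preserve the chamber of [c], hence positivity. *)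
Lemma weyl_regular : acts_regularly weyl [set pos_sum F x | x in generic].
Proof.
split.
- move=> g _ Gg [x x_gen <-]; exists (g *m x); first exact: weyl_generic.
  exact: pos_sum_weyl.
- by exists (pos_sum F c), c.
- move=> _ _ [x x_gen <-] [y y_gen <-].
  have [g Gg gx] := weyl_transitive x x_gen.
  have [h Gh hy] := weyl_transitive y y_gen.
  exists (h^T *m g); first by apply: weylM => //; exact: weyl_tr.
  by rewrite -mulmxA gx -hy mulmxA (weyl_orthogonal h Gh) mul1mx.
- move=> g _ Gg [x x_gen <-] gx.
  have [h Gh hx] := weyl_transitive x x_gen.
  have h1 := weyl_orthogonal h Gh.
  have h1' := orthogonal_trl h h1.
  pose k := h *m g *m h^T.
  have Gk : weyl k by apply: weylM; [exact: weylM | exact: weyl_tr].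
  have kc : pos_sum F (k *m c) = pos_sum F c.
    by rewrite pos_sum_weyl // -hx /k -!mulmxA (mulmxA h^T) h1 mul1mx gx.
  have k1 : k = 1%:M.
    move: (Gk); rewrite weylE => -[r /= rS rE]; rewrite -rE.
    apply: word_positive_id => // y yF y0; rewrite rE.
    rewrite -(pos_sum_inj _ _ _ (weyl_generic _ _ Gk c_gen) c_gen kc).
      2: exact: weylF.
    by rewrite dot_orthogonal //; exact: weyl_orthogonal.
  have : h^T *m k *m h = g by rewrite /k !mulmxA h1 mul1mx -mulmxA h1 mulmx1.
  by rewrite k1 mulmx1 h1.
Qed.

Lemma weyl_reflection : finite_reflection_group weyl.
Proof.
split; first exact: weyl_finite.
exists [set` simples]; split=> //=; last first.
  by move=> /simpleF /F_neq0; rewrite eqxx.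
Qed.
End ReflectionGroup.

(** * The generators of a homogeneous zonotope *)
Section ReducedZonotope.
Context {R : realType} {d : nat}.
Implicit Types (a b c x y z : 'cV[R]_d).
Variable s : seq 'cV[R]_d.
Hypothesis s_red : reduced s.

Definition roots := s ++ [seq - z | z <- s].

Let mem_opp x : (x \in [seq - z | z <- s]) = (- x \in s).
Proof. by rewrite -[x in LHS]opprK mem_map //; exact: oppr_inj. Qed.

Lemma roots_opp x : x \in roots -> - x \in roots.
Proof. by rewrite !mem_cat !mem_opp opprK orbC. Qed.

Let rootsP x : x \in roots -> x \in s \/ - x \in s.
Proof. by rewrite mem_cat mem_opp => /orP. Qed.

Lemma roots_neq0 x : x \in roots -> x != 0.
Proof.
have [_ s0 _] := s_red.
by case/rootsP => xs; apply: contraNneq s0 => x0; move: xs; rewrite x0 ?oppr0.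
Qed.

Let neq_opp x : x != 0 -> x != - x.
Proof.
move=> x0; apply: contraNneq x0 => /eqP; rewrite -addr_eq0 -mulr2n -scaler_nat.
by rewrite scaler_eq0 pnatr_eq0.
Qed.

Lemma roots_uniq : uniq roots.
Proof.
have [s_uniq s0 s_par] := s_red.
rewrite cat_uniq s_uniq (map_inj_uniq oppr_inj) s_uniq andbT /=.
apply/hasPn => x; rewrite mem_opp => nxs; apply/negP => /= xs.
have x0 : x != 0 by apply: contraNneq s0 => <-.
have := s_par x (- x) (-1) xs nxs; rewrite scaleN1r opprK => /(_ erefl)/eqP.
by rewrite (negPf (neq_opp _ x0)).
Qed.

Lemma roots_par x y k : x \in roots -> y \in roots -> x = k *: y ->
  x = y \/ x = - y.
Proof.
have [_ _ s_par] := s_red.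
move=> /rootsP[xs|xs] /rootsP[ys|ys] E.
- by left; exact: s_par E.
- by right; apply: (s_par _ _ (- k)); rewrite // scaleNr scalerN opprK.
- right; rewrite -[x]opprK; congr (- _).
  by apply: (s_par _ _ (- k)); rewrite // scaleNr -E.
- left; apply: oppr_inj.
  by apply: (s_par _ _ k); rewrite // scalerN -E.
Qed.

Lemma apex_pos_sum c : apex c s = pos_sum roots c.
Proof.
rewrite /pos_sum big_cat big_map /= big_mkcond [X in _ + X]big_mkcond -big_split.
apply: eq_bigr => z _ /=; rewrite dotNr oppr_gt0.
have [h|h|->] := ltrgt0P (dot c z).
- by rewrite gtr0_sg // scale1r addr0.
- by rewrite ltr0_sg // scaleN1r add0r.
- by rewrite sgr0 scale0r addr0.
Qed.

Lemma generic_roots c : generic roots c <-> forall y, y \in s -> dot c y != 0.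
Proof.
split=> h y ys; first by apply: h; rewrite mem_cat ys.
by case/rootsP: ys => /h //; rewrite dotNr oppr_eq0.
Qed.

Lemma vertices_zon :
  vertices (zon s) = [set pos_sum roots c | c in generic roots].
Proof.
have [_ s0 _] := s_red.
apply/seteqP; split=> [v [c]|_ [c /generic_roots c_gen <-]].
- rewrite zon_face; case fE: [seq z <- s | dot c z == 0] => [|z l] vE.
  + exists c.
      apply/generic_roots => y ys; apply/negP => cy.
      have : y \in [seq z <- s | dot c z == 0] by rewrite mem_filter cy.
      by rewrite fE.
    rewrite -apex_pos_sum.
    have : [set apex c s + w | w in zon [::]] (apex c s).
      by exists 0; rewrite ?addr0.
    by rewrite -vE.
  + have zf : z \in [seq z <- s | dot c z == 0] by rewrite fE mem_head.
    have v1 : [set v] (apex c s + 0) by rewrite vE; exists 0 => //; exact: zon0.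
    have v2 : [set v] (apex c s + z).
      by rewrite vE; exists z => //; apply: zon_mem; rewrite mem_head.
    have /addrI z0 : apex c s + 0 = apex c s + z by rewrite v1 v2.
    by move: zf; rewrite mem_filter -z0 (negPf s0) andbF.
- exists c; rewrite zon_face -apex_pos_sum.
  have -> : [seq z <- s | dot c z == 0] = [::].
    by apply/eqP; rewrite -[_ == _]negbK -has_filter; apply/hasPn.
  apply/seteqP; split=> x /=.
    by move=> ->; exists 0; rewrite ?addr0.
  by case=> w -> <-; rewrite addr0.
Qed.

Lemma has_dim_segment a z : z != 0 -> has_dim (segment (a - z) (a + z)) 1.
Proof.
move=> z0; exists a, <[z]>%VS; split; last by rewrite dim_vline z0.
apply/seteqP; split=> x /=.
- case=> n [p [w [p_seg w1 ->]]].
  have {p_seg}/choice [t tP] : forall i, exists t : R, p i = a + t *: z.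
    move=> i; have [t _ <-] := p_seg i; exists (2 * t - 1).
    by apply/matrixP => k l; rewrite !mxE; ring.
  exists ((\sum_i w i * t i) *: z); first by rewrite /= memvZ // memv_line.
  rewrite -[a in LHS]scale1r -w1 !scaler_suml -big_split /=.
  by apply: eq_bigr => i _; rewrite tP scalerDr scalerA.
- case=> u /= /vlineP[k ->] <-.
  exists 2, (fun i => if i == ord0 then a - z else a + z),
    (fun i => if i == ord0 then (1 - k) / 2 else (1 + k) / 2); split.
  + move=> i; case: ifP => _; [exists 0|exists 1];
      rewrite /= ?in_itv /= ?lexx ?ler01 //.
      by rewrite scale0r addr0 subr0 scale1r.
    by rewrite subrr scale0r add0r scale1r.
  + by rewrite !big_ord_recl big_ord0 /=; field.
  + rewrite !big_ord_recl big_ord0 /=.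
    by apply/matrixP => i j; rewrite !mxE; field.
Qed.

Lemma edge_zon z : z \in s -> exists a, edge (zon s) (segment (a - z) (a + z)).
Proof.
have [s_uniq s0 s_par] := s_red.
move=> zs; have z0 : z != 0 by apply: contraNneq s0 => <-.
have [c cz c_gen] := generic_perp z [seq y <- s | y != z].
exists (apex c s); split; last exact: has_dim_segment.
exists c; rewrite zon_face.
have -> : [seq y <- s | dot c y == 0] = [:: z].
  have -> : [:: z] = [seq y <- s | y == z].
    by rewrite -[RHS]/(filter (pred1 z) s) filter_pred1_uniq.
  apply: eq_in_filter => y ys; apply/idP/idP => [|/eqP->]; last by rewrite cz.
  apply: contraTT => yz; apply: c_gen; first by rewrite mem_filter yz.
  by move=> k; apply: contraNneq yz => E; apply/eqP; exact: s_par E.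
apply/seteqP; split=> x /=.
- case=> t; rewrite /= in_itv /= => t01 <-; exists ((2 * t - 1) *: z).
    exists 0, (2 * t - 1); split; rewrite ?add0r //; lra.
  by apply/matrixP => k l; rewrite !mxE; ring.
- case=> _ [_ [t [-> t1 ->]]] <-; exists ((1 + t) / 2).
    by rewrite /= in_itv /=; lra.
  by apply/matrixP => k l; rewrite !mxE; field.
Qed.

Lemma roots_norm : homogeneous (zon s) ->
  exists2 q, 0 < q & forall x, x \in roots -> dot x x = q.
Proof.
case=> _ [l edge_l]; have [s0|s_n0] := eqVneq s [::].
  by exists 1 => // x; rewrite /roots s0.
have norm_s z : z \in s -> dot z z = l ^+ 2 / 4.
  move=> zs; have [a a_edge] := edge_zon z zs.
  rewrite -(edge_l _ _ a_edge) enorm_sq.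
  have -> : a - z - (a + z) = - (2 *: z).
    by rewrite scaler_nat mulr2n opprD addrACA subrr add0r opprD.
  by rewrite !dot_lin; field.
have norm_roots x : x \in roots -> dot x x = l ^+ 2 / 4.
  by case/rootsP => /norm_s //; rewrite !dot_lin opprK.
exists (l ^+ 2 / 4) => //.
have [z zs] : exists z, z \in s.
  by case: (s) s_n0 => // z s' _; exists z; exact: mem_head.
by rewrite -(norm_s z zs) dot_gt0 // roots_neq0 // mem_cat zs.
Qed.

Lemma pos_sum_opp c : pos_sum roots (- c) = - pos_sum roots c.
Proof.
rewrite /pos_sum (perm_big _ (perm_opp roots roots_uniq roots_opp)) big_map -sumrN.
by apply: eq_bigl => y; rewrite dotNl dotNr opprK.
Qed.

(** The vertex opposite to [v] is [-v], so the centre [o] of the sphere is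
    orthogonal to all vertices and they also lie on a sphere around 0. *)
Lemma sphere_centered : homogeneous (zon s) -> exists r, forall c,
  generic roots c -> dot (pos_sum roots c) (pos_sum roots c) = r.
Proof.
case=> -[o [rho o_rho]] _; exists (rho ^+ 2 - dot o o) => c c_gen.
have vc : vertices (zon s) (pos_sum roots c).
  by rewrite vertices_zon; exists c.
have vNc : vertices (zon s) (- pos_sum roots c).
  rewrite vertices_zon; exists (- c); last exact: pos_sum_opp.
  by move=> y yr; rewrite dotNl oppr_eq0 c_gen.
have := congr1 (fun t => t ^+ 2) (o_rho _ vc).
have := congr1 (fun t => t ^+ 2) (o_rho _ vNc).
rewrite /= !enorm_sq !dot_lin (dotC o); lra.
Qed.

(** The face exposed by [c] is the edge through [T c] in direction [x], where [T]
    is [pos_sum roots]. Tilting [c] towards [x] selects one endpoint. *)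
Lemma adjacent_vertex x c : x \in roots -> dot c x = 0 ->
  (forall y, y \in roots -> dot c y = 0 -> y = x \/ y = - x) ->
  exists2 c', generic roots c' & pos_sum roots c' = pos_sum roots c + x.
Proof.
move=> xr cx c_gen; have [t t0 ht] := perturb roots c x.
have xx := dot_gt0 _ (roots_neq0 _ xr).
have sg_off y : y \in roots -> dot c y != 0 ->
    Num.sg (dot (c + t *: x) y) = Num.sg (dot c y).
  by move=> yr cy; rewrite ht // gtr0_norm.
have xNx : - x != x by rewrite eq_sym neq_opp // roots_neq0.
exists (c + t *: x).
  move=> y yr; have [cy|cy] := eqVneq (dot c y) 0; last first.
    by rewrite -sgr_eq0 sg_off ?sgr_eq0.
  by rewrite dotDl dotZl cy add0r; case: (c_gen y yr cy) => ->;
    rewrite ?dotNr mulf_neq0 ?oppr_eq0 ?gt_eqF.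
rewrite /pos_sum -big_filter (bigD1_seq x) ?filter_uniq ?roots_uniq //=; last first.
  by rewrite mem_filter xr dotDl dotZl cx add0r mulr_gt0.
rewrite addrC big_filter_cond; congr (_ + _).
rewrite big_seq_cond [RHS]big_seq_cond; apply: eq_bigl => y.
case yr: (y \in roots) => //=; have [->|yx] := eqVneq y x.
  by rewrite cx ltxx andbF.
rewrite andbT; have [cy|cy] := eqVneq (dot c y) 0; last first.
  by rewrite -sgr_gt0 sg_off ?sgr_gt0.
case: (c_gen y yr cy) => yE; first by rewrite yE eqxx in yx.
by rewrite cy ltxx dotDl dotZl cy add0r yE dotNr mulrN oppr_gt0 ltNge ltW // mulr_gt0.
Qed.

Lemma roots_balanced x c : homogeneous (zon s) -> x \in roots -> dot c x = 0 ->
  (forall y, y \in roots -> dot c y = 0 -> y = x \/ y = - x) ->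
  dot (pos_sum roots c) x = 0.
Proof.
move=> /sphere_centered[r sphere] xr cx c_gen.
have [c1 /sphere c1_sphere E1] := adjacent_vertex x c xr cx c_gen.
have [|||c2 /sphere c2_sphere E2] := adjacent_vertex (- x) c.
- exact: roots_opp.
- by rewrite dotNr cx oppr0.
- by move=> y yr cy; rewrite opprK; case: (c_gen y yr cy); [right|left].
move: c1_sphere c2_sphere; rewrite E1 E2 !dot_lin (dotC x); lra.
Qed.

Lemma roots_span : full_dimensional (zon s) ->
  forall x, (forall y, y \in roots -> dot x y = 0) -> x = 0.
Proof.
case=> a [U [affE dimU]] x x_perp.
have x_zon z : zon s z -> dot x z = 0.
  have xs y : y \in s -> dot x y = 0 by move=> ys; apply: x_perp; rewrite mem_cat ys.
  elim: s xs z => [_ z ->|y s' IH xs z [w [t [ws _ ->]]]]; first exact: dot0r.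
  rewrite dotDr dotZr (IH _ w) // ?xs ?mem_head ?mulr0 ?addr0 //.
  by move=> v vs'; apply: xs; rewrite inE vs' orbT.
have UT : U = fullv.
  by apply/eqP; rewrite eqEdim subvf dimvf dimU /dim /= muln1.
have x_aff u : dot x (a + u) = 0.
  have : aff_hull (zon s) (a + u).
    by rewrite affE; exists u => //=; rewrite UT memvf.
  case=> n [p [w [ps _ ->]]]; rewrite dot_sumr big1 // => i _.
  by rewrite dotZr x_zon ?mulr0.
apply/eqP; rewrite -dot_eq0; apply/eqP.
by have := x_aff x; have := x_aff 0; rewrite addr0 dotDr => ->; rewrite add0r.
Qed.

End ReducedZonotope.

(** Otherwise the translate by [2 m] of a point of [zon s] farthest in direction
    [m] would be a point of [zon s] that is still farther. *)
Lemma zon_symmetric_center {R : realType} {d : nat} (s : seq 'cV[R]_d) m :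
  let Z := [set m + x | x in zon s] in Z = [set - x | x in Z] -> m = 0.
Proof.
move=> Z Z_sym; pose t := apex m s.
have [ts _] := zon_apex_face m s 0 (zon0 _); rewrite addr0 -/t in ts.
have zon_opp x : zon s x -> zon s (- x).
  elim: s {Z Z_sym t ts} x => [|z s IH] x /=; first by move=> ->; rewrite oppr0.
  case=> w [k [/IH ws k1 ->]]; exists (- w), (- k); split=> //; first lra.
  by rewrite opprD scaleNr.
have : Z (m + t) by exists t.
rewrite Z_sym => -[_ [w /zon_opp ws <-]] => E.
have := zon_le_apex m s _ ws; rewrite -/t.
have -> : - w = 2 *: m + t.
  by rewrite scaler_nat mulr2n -addrA -E opprD addrA subrr add0r.
rewrite !dot_lin => h; apply/eqP; rewrite -dot_eq0; apply/eqP/le_anti.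
by rewrite dot_ge0 andbT; lra.
Qed.

Theorem corollary4p6 (R : realType) (d : nat) (Z : set 'cV[R]_d)
    (d_ge2 : (2 <= d)%N)
    (Z_zonotope : zonotope Z)
    (Z_full : full_dimensional Z)
    (Z_sym : Z = [set - x | x in Z])
    (Z_homogeneous : homogeneous Z) :
  exists G : set 'M[R]_d, finite_reflection_group G /\ permutahedron G Z.
Proof.
have Z_polytope : polytope Z by case: Z_zonotope.
have [m [s0 ZE]] := zonotope_zon Z Z_zonotope.
have m0 : m = 0 by apply: (zon_symmetric_center s0); rewrite -ZE.
have [s s_red zs] := reduced_zon s0.
have {m0 zs}ZE : Z = zon s.
  rewrite ZE m0 zs; apply/seteqP; split=> x /=.
    by case=> w ws <-; rewrite add0r.
  by move=> xs; exists x; rewrite ?add0r.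
rewrite {Z_zonotope Z_sym}ZE in Z_polytope Z_full Z_homogeneous *.
have [q q_gt0 r_norm] := roots_norm s s_red Z_homogeneous.
have r_uniq := roots_uniq s s_red.
have r_opp := roots_opp s.
have r_refl x y : x \in roots s -> y \in roots s -> reflection x *m y \in roots s.
  apply: (balanced_reflection_closed _ _ r_uniq r_opp _ q_gt0 r_norm).
    exact: roots_par.
  by move=> z c; exact: roots_balanced.
have r_span := roots_span s Z_full.
have [||y yr|c _ c_gen] :=
  generic_in_subspace (fun _ : 'cV[R]_d => True) (roots s) => //.
  by exists y; rewrite ?dot_eq0 ?(roots_neq0 s s_red).
exists (weyl (roots s) c); split; first exact: (weyl_reflection _ q).
split=> //; rewrite vertices_zon //.
exact: (weyl_regular _ q).
Qed.
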